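(* For all integers $n\ge1$ and $0\le l\le n-1$, $$c_{n,n,l}^{(\lambda,\theta)}=\sum_{v=0}^{n-l-1}\alpha_v^{(n,\lambda,\theta)}\,\gamma_{n-l-1-v}^{(n,\theta)},$$ where, for $0\le a\le n-l-1$, $$\gamma_a^{(n,\theta)}=\sum_{\substack{v_1\ge0,\dots,v_a\ge0\\ v_1+2v_2+\cdots+av_a=a}}\frac{(v_1+\cdots+v_a)!}{v_1!\cdots v_a!}\,(-\beta_1^{(n,\theta)})^{v_1}\cdots(-\beta_a^{(n,\theta)})^{v_a}$$ (with $\gamma_0^{(n,\theta)}=1$).
   Context: Fix $\lambda\in(0,1]$, $\theta\in(0,1)$. $(x)_N=x(x+1)\cdots(x+N-1)$ is the Pochhammer symbol. For integers $1\le h\le n$ and $0\le l\le n-1$ define polynomials in $d$, with coefficients that are polynomials in the variables $j,k$: $$P_{n,h}(j,k,d)=(d-2j-1)(d+2h-2j-1)(d-j)_h((1-\theta)d-j)_h(\lambda\theta d+h-n-j+k)_n(\theta d+h-n-j+k)_n,$$ $$D_{n,h,l}(j,k,d)=\lambda\theta\, d^{l+1}(d+h-2j-1)(\theta d-j)_h(d-n+h-2j-1+k)_{n+h+1}.$$ $Q_{n,h,l}(j,k,d)$ is the quotient in the polynomial long division, with respect to the variable $d$, of $P_{n,h}(j,k,d)$ by $D_{n,h,l}(j,k,d)$; it has degree $n-l-1$ in $d$ and is written $Q_{n,h,l}(j,k,d)=\sum_{i=0}^{n-l-1}q^{(n,h)}_{n-l-1-i}(j,k)d^i$, where the $q_i^{(n,h)}(j,k)$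 are polynomials in $j,k$ not depending on $l$. For $0\le l\le h-1\le n-1$, $c_{n,h,l}^{(\lambda,\theta)}$ denotes the coefficient of the monomial $j^{h-l-1}k^{n-h}$ in $q_{n-l-1}^{(n,h)}(j,k)$. Moreover, for $i\ge0$, $$\alpha_i^{(n,\lambda,\theta)}=(-1)^i\sum_{i_1+i_2+i_3+i_4+i_5=i}\binom{2}{i_1}\binom{n}{i_2}\binom{n}{i_3}\binom{n}{i_4}\binom{n}{i_5}2^{i_1}(\lambda\theta)^{n-1-i_3}(1-\theta)^{n-i_4}\theta^{-i_5},$$ and, for $i\ge1$, $$\beta_i^{(n,\theta)}=(-1)^i\sum_{i_1+i_2+i_3=i}\binom{1}{i_1}\binom{n}{i_2}\binom{2n+1}{i_3}2^{i_1+i_3}\theta^{-i_2},$$ the sums being over nonnegative integers. *)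

(* Defs.v *)
From mathcomp Require Import all_boot all_order all_algebra.
From mathcomp Require Import zify.
Set Implicit Arguments.
Unset Strict Implicit.
Unset Printing Implicit Defensive.
Import Order.TTheory GRing.Theory Num.Theory.
Local Open Scope ring_scope.

(* R[k][j][d]: the outermost variable is d, the innermost one is k *)
Notation polyjkd R := {poly {poly {poly R}}}.

Definition vard (R : fieldType) : polyjkd R := 'X.
Definition varj (R : fieldType) : polyjkd R := 'X%:P.
Definition vark (R : fieldType) : polyjkd R := 'X%:P%:P.
Definition cst (R : fieldType) (x : R) : polyjkd R := x%:P%:P%:P.

Definition poch (A : comNzRingType) (x : A) (N : nat) : A :=
  \prod_(i < N) (x + i%:R).

Section Quotient.
Variables (R : fieldType) (lam theta : R).

Local Notation d := (vard R).
Local Notation j := (varj R).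
Local Notation k := (vark R).

Definition Ppol (n h : nat) : polyjkd R :=
  (d - 2%:R * j - 1) * (d + 2%:R * h%:R - 2%:R * j - 1)
  * poch (d - j) h * poch (cst (1 - theta) * d - j) h
  * poch (cst (lam * theta) * d + h%:R - n%:R - j + k) n
  * poch (cst theta * d + h%:R - n%:R - j + k) n.

Definition Dpol (n h l : nat) : polyjkd R :=
  cst (lam * theta) * d ^+ l.+1 * (d + h%:R - 2%:R * j - 1)
  * poch (cst theta * d - j) h
  * poch (d - n%:R + h%:R - 2%:R * j - 1 + k) (n + h + 1).

(* Polydiv's division is a pseudo-division in general; it is the exact long
   division here because the leading coefficient of Dpol in d is a unit
   (Dpol_lead_unit and Ppol_divE below). *)
Definition Qpol (n h l : nat) : polyjkd R := Ppol n h %/ Dpol n h l.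

(* q_i^{(n,h)}, meant for 0 <= i <= n - 1.  It is read off Q_{n,h,0}; that every
   Q_{n,h,l} has the same coefficients is Qpol_expansion below. *)
Definition qcoef (n h i : nat) : {poly {poly R}} := (Qpol n h 0)`_(n - 1 - i).

(* the coefficient of j^(h-l-1) k^(n-h) in q_{n-l-1}, for l <= h - 1 *)
Definition ccoef (n h l : nat) : R :=
  ((qcoef n h (n - l - 1))`_(h - l - 1))`_(n - h).

(* Integer exponents: n - 1 - i3 is -1 when i3 = n. *)
Definition alpha (n i : nat) : R :=
  (-1) ^+ i *
  \sum_(i1 < i.+1) \sum_(i2 < i.+1) \sum_(i3 < i.+1) \sum_(i4 < i.+1)
  \sum_(i5 < i.+1 | (i1 + i2 + i3 + i4 + i5 == i)%N)
    'C(2, i1)%:R * 'C(n, i2)%:R * 'C(n, i3)%:R * 'C(n, i4)%:R * 'C(n, i5)%:R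
    * 2%:R ^+ i1 * (lam * theta) ^ (n%:Z - 1 - i3%:Z)
    * (1 - theta) ^ (n%:Z - i4%:Z) * theta ^ (- i5%:Z).

Definition beta (n i : nat) : R :=
  (-1) ^+ i *
  \sum_(i1 < i.+1) \sum_(i2 < i.+1)
  \sum_(i3 < i.+1 | (i1 + i2 + i3 == i)%N)
    'C(1, i1)%:R * 'C(n, i2)%:R * 'C(2 * n + 1, i3)%:R
    * 2%:R ^+ (i1 + i3) * theta ^ (- i2%:Z).

(* The component v s, with s : 'I_a, is the exponent v_(s+1). The constraint
   forces v_(s+1) <= a, so the bound in 'I_a.+1 loses nothing.
   The multinomial coefficient is a quotient in R, so R should have
   characteristic 0. *)
Definition gamma (n a : nat) : R :=
  \sum_(v : {ffun 'I_a -> 'I_a.+1} | (\sum_(s < a) s.+1 * v s == a)%N)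
    ((\sum_(s < a) v s)%N`!)%:R / (\prod_(s < a) (v s)`!)%:R
    * \prod_(s < a) (- beta n s.+1) ^+ v s.

End Quotient.

Section WellDefined.
Variables (R : fieldType) (lam theta : R).
Hypotheses (lam_neq0 : lam != 0) (theta_neq0 : theta != 0) (theta_neq1 : theta != 1).

(* p has degree m in d, with leading coefficient the nonzero constant x *)
Let lc (m : nat) (x : R) (p : polyjkd R) :=
  [/\ size p = m.+1, lead_coef p = x%:P%:P & x != 0].

Let lcM m x p m' x' p' : lc m x p -> lc m' x' p' -> lc (m + m') (x * x') (p * p').
Proof.
move=> [sp lp x0] [sp' lp' x0']; split; last by rewrite mulf_neq0.
  rewrite size_mul ?sp ?sp' ?addnS //; first by rewrite -size_poly_gt0 sp.
  by rewrite -size_poly_gt0 sp'.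
by rewrite lead_coefM lp lp' -!polyCM.
Qed.

Let lc_lin (a : R) (c : {poly {poly R}}) : a != 0 ->
  lc 1 a (cst a * vard R + c%:P).
Proof.
move=> a0; have a0' : a%:P%:P != 0 :> {poly {poly R}} by rewrite !polyC_eq0.
have s2 : size (cst a * vard R) = 2%N.
  by rewrite /cst mul_polyC size_scale // size_polyX.
have sc : (size c%:P < size (cst a * vard R)%R)%N.
  by rewrite s2 (leq_ltn_trans (size_polyC_leq1 _)).
split=> //; first by rewrite size_polyDl // s2.
by rewrite lead_coefDl // /cst mul_polyC lead_coefZ lead_coefX mulr1.
Qed.

Let lc_poch (a : R) (c : {poly {poly R}}) N : a != 0 ->
  lc N (a ^+ N) (poch (cst a * vard R + c%:P) N).
Proof.
move=> a0; rewrite /poch; elim: N => [|N IH].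
  by rewrite big_ord0; split; rewrite ?size_poly1 ?lead_coef1 ?oner_neq0.
rewrite big_ord_recr /= -addn1 exprD expr1; apply: lcM => //.
by rewrite -addrA -polyC_natr -polyCD; apply: lc_lin.
Qed.

Let polyCE := (polyCD, polyCN, polyCM, polyC1, polyC_natr).

Let vardE : vard R = cst 1 * vard R.
Proof. by rewrite /cst !polyC1 mul1r. Qed.

Let lin1 c (p : polyjkd R) : p = vard R + c%:P -> lc 1 1 p.
Proof. by move=> ->; rewrite vardE; apply/lc_lin/oner_neq0. Qed.

Let poch1 c N (p : polyjkd R) : p = vard R + c%:P -> lc N 1 (poch p N).
Proof.
by move=> ->; have := lc_poch c N (oner_neq0 R); rewrite expr1n -vardE.
Qed.

Let pochc a c N (p : polyjkd R) : a != 0 -> p = cst a * vard R + c%:P ->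
  lc N (a ^+ N) (poch p N).
Proof. by move=> a0 ->; apply: lc_poch. Qed.

Let lc_Ppol n h : lc (2 * h + 2 * n + 2)
  ((1 - theta) ^+ h * (lam * theta) ^+ n * theta ^+ n) (Ppol lam theta n h).
Proof.
have lt0 : lam * theta != 0 by rewrite mulf_neq0.
have t1 : 1 - theta != 0 by rewrite subr_eq0 eq_sym.
have f1 : lc 1 1 (vard R - 2%:R * varj R - 1).
  by apply: (@lin1 (- (2%:R * 'X) - 1)); rewrite !polyCE !addrA.
have f2 : lc 1 1 (vard R + 2%:R * h%:R - 2%:R * varj R - 1).
  by apply: (@lin1 (2%:R * h%:R - 2%:R * 'X - 1)); rewrite !polyCE !addrA.
have f3 : lc h 1 (poch (vard R - varj R) h).
  by apply: (@poch1 (- 'X)); rewrite !polyCE.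
have f4 : lc h ((1 - theta) ^+ h) (poch (cst (1 - theta) * vard R - varj R) h).
  by apply: (@pochc _ (- 'X)); rewrite ?polyCN.
have f5 a : a != 0 -> lc n (a ^+ n)
    (poch (cst a * vard R + h%:R - n%:R - varj R + vark R) n).
  move=> a0; apply: (@pochc _ (h%:R - n%:R - 'X + 'X%:P)) => //.
  by rewrite !polyCE !addrA.
have := lcM (lcM (lcM (lcM (lcM f1 f2) f3) f4) (f5 _ lt0)) (f5 _ theta_neq0).
rewrite !mul1r (_ : 1 + 1 + h + h + n + n = 2 * h + 2 * n + 2)%N //.
by lia.
Qed.

Let lc_Dpol n h l :
  lc (n + 2 * h + l + 3) (lam * theta * theta ^+ h) (Dpol lam theta n h l).
Proof.
have lt0 : lam * theta != 0 by rewrite mulf_neq0.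
have f1 : lc l.+1 (lam * theta) (cst (lam * theta) * vard R ^+ l.+1).
  have c0 : (lam * theta)%:P%:P != 0 :> {poly {poly R}} by rewrite !polyC_eq0.
  split=> //; rewrite /cst mul_polyC ?size_scale ?size_polyXn //.
  by rewrite lead_coefZ lead_coefXn mulr1.
have f2 : lc 1 1 (vard R + h%:R - 2%:R * varj R - 1).
  by apply: (@lin1 (h%:R - 2%:R * 'X - 1)); rewrite !polyCE !addrA.
have f3 : lc h (theta ^+ h) (poch (cst theta * vard R - varj R) h).
  by apply: (@pochc _ (- 'X)); rewrite ?polyCN.
have f4 : lc (n + h + 1) 1
    (poch (vard R - n%:R + h%:R - 2%:R * varj R - 1 + vark R) (n + h + 1)).
  apply: (@poch1 (- n%:R + h%:R - 2%:R * 'X - 1 + 'X%:P)).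
  by rewrite !polyCE !addrA.
have := lcM (lcM (lcM f1 f2) f3) f4.
by rewrite !mulr1 (_ : l.+1 + 1 + h + (n + h + 1) = n + 2 * h + l + 3)%N //; lia.
Qed.

Lemma Dpol_lead_unit n h l :
  lead_coef (Dpol lam theta n h l) \is a GRing.unit.
Proof.
have [_ -> x0] := lc_Dpol n h l.
by rewrite !poly_unitE !coefC /= !size_polyC polyC_eq0 x0 unitfE.
Qed.

Lemma Ppol_divE n h l :
  Ppol lam theta n h = Qpol lam theta n h l * Dpol lam theta n h l
    + Ppol lam theta n h %% Dpol lam theta n h l.
Proof. exact: (Pdiv.IdomainUnit.divp_eq (Dpol_lead_unit n h l)). Qed.

Lemma size_Qpol n h l : (l <= n - 1)%N -> (1 <= n)%N ->
  size (Qpol lam theta n h l) = (n - l - 1).+1.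
Proof.
move=> ln n0; have [sP _ _] := lc_Ppol n h; have [sD _ _] := lc_Dpol n h l.
rewrite size_divp ?sP ?sD; first by lia.
by rewrite -size_poly_gt0 sD.
Qed.

Lemma Qpol_expansion n h l : (1 <= n)%N -> (l <= n - 1)%N ->
  Qpol lam theta n h l =
  \sum_(0 <= i < n - l) (qcoef lam theta n h (n - l - 1 - i))%:P * vard R ^+ i.
Proof.
move=> n0 ln.
have D0 m : Dpol lam theta n h m != 0.
  by have [sD _ _] := lc_Dpol n h m; rewrite -size_poly_gt0 sD.
have DE : Dpol lam theta n h l = 'X^l * Dpol lam theta n h 0.
  have aux (c x y a b e : polyjkd R) :
      c * (x * y) * a * b * e = y * (c * x * a * b * e).
    by rewrite mulrA [c * x * y]mulrC -!mulrA.
  by rewrite /Dpol exprS expr1 aux.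
have U := Dpol_lead_unit n h 0.
pose r : polyjkd R := Ppol lam theta n h %% Dpol lam theta n h l.
have Q0E : Qpol lam theta n h 0
    = Qpol lam theta n h l * 'X^l + r %/ Dpol lam theta n h 0.
  rewrite {1}/Qpol (Ppol_divE n h l) DE mulrA Pdiv.IdomainUnit.divpD //.
  by rewrite Pdiv.IdomainUnit.mulpK // -DE.
have sr : (size (r %/ Dpol lam theta n h 0)%R <= l)%N.
  have := Pdiv.CommonIdomain.ltn_modpN0 (Ppol lam theta n h) (D0 l); rewrite -/r.
  have [sD _ _] := lc_Dpol n h l; have [sD' _ _] := lc_Dpol n h 0.
  rewrite size_divp ?D0 // sD sD'; set s := size _ => hs; clearbody s; lia.
apply/polyP=> m; under eq_bigr do rewrite mul_polyC.
rewrite big_mkord -(poly_def _ (fun i => qcoef lam theta n h (n - l - 1 - i))).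
rewrite coef_poly; case: ltnP => mn; last first.
  by rewrite nth_default // size_Qpol //; lia.
rewrite /qcoef Q0E coefD coefMXn (_ : n - 1 - _ = m + l)%N; last by lia.
rewrite ltnNge leq_addl /= addnK [X in _ + X]nth_default ?addr0 //.
by rewrite (leq_trans sr) // leq_addl.
Qed.

End WellDefined.

(* Main.v *)
Require Import Defs.
From mathcomp Require Import all_boot all_order all_algebra.
From mathcomp Require Import zify ring.
Set Implicit Arguments.
Unset Strict Implicit.
Unset Printing Implicit Defensive.
Import Order.TTheory GRing.Theory Num.Theory.
Local Open Scope ring_scope.

(** For [h = n] the coefficient in question is that of the monomial
    [d^l j^(n-l-1)] of the quotient.  It survives at [k = 0], where its degree
    [n - 1] is the largest total degree in [(d, j)] that the quotient reaches.  Top homogeneous parts multiply, so everything happens between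
    the top parts of the dividend and of the divisor.  Dehomogenized in
    [x = j / d], these are
[[
      (1-2x)^2 (1-x)^n ((1-theta)-x)^n (lam theta - x)^n (theta-x)^n
]]
    and
[[
      lam theta (1-2x) (theta-x)^n (1-2x)^(2n+1).
]]
    The remainder has small degree in [d], so its top part is divisible by
    [x^n] and does not disturb the coefficients of [x^0, ..., x^(n-1)].  Up to
    the common factor [lam theta^(n+1)], these are the polynomials [numer] and
    [denom] below.  Hence the coefficient of [d^l j^(n-l-1)] in the quotient is
    the coefficient of [x^(n-l-1)] in the power series [numer / denom].

    Multiplying out binomial expansions shows that [alpha] lists the
    coefficients of [numer] ([alphaE]) and [beta] those of [denom] ([betaE]).
    Since [denom] has constant term 1, its inverse is the geometric series
    in [1 - denom], and the multinomial theorem turns the coefficients of that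
    series into the sum over partitions defining [gamma] ([coef_geometric],
    [gammaE]).

    Top parts are handled by the ring morphism [grad], which sends [d] to [T],
    [j] to [x T] and [k] to 0: the total degree becomes the degree in [T], and
    the top part becomes a leading coefficient.  [grad_division] transfers the
    division through it. *)

(** * The multinomial theorem *)

Section Multinomial.
Variables (F : numFieldType) (A : comAlgType F).

Definition trunc_exp (M : nat) (x : A) : {poly A} :=
  \poly_(e < M) (e`!%:R^-1 *: x ^+ e).

Lemma fact_natr_neq0 m : m`!%:R != 0 :> F.
Proof. by rewrite pnatr_eq0 -lt0n fact_gt0. Qed.

(** Below the truncation order, truncated exponentials multiply like
    [exp (x T) * exp (y T) = exp ((x + y) T)]: this is the binomial theorem. *)
Lemma coef_prod_trunc_exp (I : finType) (x : I -> A) M m : (m < M)%N ->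
  (\prod_i trunc_exp M (x i))`_m = m`!%:R^-1 *: (\sum_i x i) ^+ m.
Proof.
move: m; elim/big_rec2: _ => [|i y p _ IH] m mM.
  rewrite coef1; case: m mM => [|m] _; last by rewrite expr0n scaler0.
  by rewrite expr0 fact0 invr1 scale1r.
rewrite coefM addrC exprDn scaler_sumr.
apply: eq_bigr => -[e /=]; rewrite ltnS => em _.
rewrite coef_poly (leq_ltn_trans em mM) IH ?(leq_ltn_trans (leq_subr _ _)) //.
rewrite -scalerAr -scalerAl scalerA -scaler_nat scalerA.
congr (_ *: _); last by rewrite mulrC.
have := bin_fact em => /(congr1 (fun k => k%:R : F)) /esym E.
rewrite E !natrM; field.
by rewrite !fact_natr_neq0 /= pnatr_eq0 -lt0n bin_gt0.
Qed.

(** Both sides are the coefficient of [T^m] in the product of the truncated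
    exponentials of the [x s], up to the factor [m!]; the right-hand side comes
    from distributing that product over its sums.  The bound [M] only makes the
    type of exponents finite. *)
Lemma multinomial_theorem (N M m : nat) (x : 'I_N -> A) : (m < M)%N ->
  (\sum_s x s) ^+ m =
  \sum_(v : {ffun 'I_N -> 'I_M} | (\sum_s v s == m)%N)
    (m`!%:R / (\prod_s (v s)`!)%:R) *: \prod_s x s ^+ v s.
Proof.
move=> mM; have := coef_prod_trunc_exp x mM.
have -> : \prod_s trunc_exp M (x s) = \sum_(v : {ffun 'I_N -> 'I_M})
   ((\prod_s (v s)`!)%:R^-1 *: \prod_s x s ^+ v s) *: 'X^(\sum_s v s)%N.
  under eq_bigr do rewrite /trunc_exp poly_def.
  rewrite bigA_distr_bigA; apply: eq_bigr => v _.
  by rewrite natr_prod -prodfV -scaler_prod expr_sum -scaler_prod.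
rewrite coef_sumMXn => /(congr1 (fun z => m`!%:R *: z)).
rewrite scalerA divff ?fact_natr_neq0 // scale1r => <-.
by rewrite scaler_sumr; apply: eq_bigr => v _; rewrite scalerA.
Qed.
End Multinomial.

(** * Coefficients of powers, inverses and products *)

Section PowerSeries.
Variable F : numFieldType.
Implicit Types p q u t w : {poly F}.

Lemma coef_exp_low u m a : u`_0 = 0 -> (a < m)%N -> (u ^+ m)`_a = 0.
Proof.
move=> u0; elim: m a => // m IH a am.
rewrite exprS coefM big1 // => -[[|i] /= ia] _; first by rewrite u0 mul0r.
by rewrite IH ?mulr0 //; lia.
Qed.

Lemma coef_exp_trunc u w m a : (forall i, (i <= a)%N -> u`_i = w`_i) ->
  (u ^+ m)`_a = (w ^+ m)`_a.
Proof.
move=> uw; elim: m a uw => // m IH a uw; rewrite !exprS !coefM.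
apply: eq_bigr => -[i /= ia] _; rewrite uw; last by lia.
by congr (_ * _); apply: IH => k ka; apply: uw; lia.
Qed.

(** Up to degree [a], [u] is the sum of its [a] monomials of degree 1 to [a],
    whose powers expand by the multinomial theorem.  The exponent [v s] goes
    with the monomial of degree [s + 1]; the weight [a] of [v] bounds its sum,
    so powers of [u] beyond the [a]-th contribute nothing. *)
Lemma coef_geometric u N a : u`_0 = 0 -> (a < N)%N ->
  (\sum_(m < N) u ^+ m)`_a =
  \sum_(v : {ffun 'I_a -> 'I_a.+1} | (\sum_(s < a) s.+1 * v s == a)%N)
    ((\sum_(s < a) v s)%N`!)%:R / (\prod_(s < a) (v s)`!)%:R
    * \prod_(s < a) u`_s.+1 ^+ v s.
Proof.
move=> u0 aN; pose w := \sum_(s < a) u`_s.+1 *: 'X^(s.+1).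
have uw i : (i <= a)%N -> u`_i = w`_i.
  rewrite /w coef_sumMXn; case: i => [|i] ia; first by rewrite big_pred0.
  by rewrite (big_pred1 (Ordinal ia)).
rewrite coef_sum -(big_mkord xpredT (fun m => (u ^+ m)`_a)).
rewrite (@big_cat_nat _ _ _ a.+1) //= [X in _ + X]big_nat_cond.
rewrite [X in _ + X]big1 ?addr0; last first.
  by move=> m /andP[/andP[am _] _]; rewrite coef_exp_low.
rewrite big_mkord.
have le_v (v : {ffun 'I_a -> 'I_a.+1}) : (\sum_(s < a) s.+1 * v s == a)%N ->
    (\sum_(s < a) v s < a.+1)%N.
  move=> /eqP va; rewrite ltnS -[X in (_ <= X)%N]va.
  by apply: leq_sum => s _; rewrite leq_pmull.
rewrite (partition_big (fun v : {ffun 'I_a -> 'I_a.+1} =>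
  inord (\sum_(s < a) v s) : 'I_a.+1) xpredT) //=.
apply: eq_bigr => -[m /= mM] _.
rewrite (coef_exp_trunc _ uw) /w (multinomial_theorem _ mM) coef_sum.
have monoE (v : {ffun 'I_a -> 'I_a.+1}) :
    \prod_(s < a) (u`_s.+1 *: 'X^(s.+1)) ^+ v s =
    (\prod_(s < a) u`_s.+1 ^+ v s) *: 'X^(\sum_(s < a) s.+1 * v s).
  by rewrite expr_sum -scaler_prod; apply: eq_bigr => s _; rewrite exprZn exprM.
have mono_coefE (v : {ffun 'I_a -> 'I_a.+1}) (x : F) :
    (x *: \prod_(s < a) (u`_s.+1 *: 'X^(s.+1)) ^+ v s)`_a =
    x * \prod_(s < a) u`_s.+1 ^+ v s * (a == \sum_(s < a) s.+1 * v s)%N%:R.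
  by rewrite monoE scalerA coefZ coefXn.
rewrite (eq_bigr _ (fun v _ => mono_coefE v _)).
rewrite (bigID (fun v : {ffun 'I_a -> 'I_a.+1} =>
  \sum_(s < a) s.+1 * v s == a)%N) /=.
rewrite [X in _ + X]big1 ?addr0; last first.
  by move=> v /andP[_ va]; rewrite eq_sym (negPf va) mulr0.
apply: eq_big => v.
  rewrite andbC; case: eqP => //= va; rewrite -val_eqE /= inordK //.
  by apply: le_v; apply/eqP.
by move=> /andP[/eqP <- /eqP ->]; rewrite eqxx mulr1.
Qed.

(** The geometric sum [S] satisfies [q * S = 1 - (1 - q)^N], so
    [t = (t * q) * S] up to terms of degree at least [N]. *)
Lemma coef_quotient p q t N i : q`_0 = 1 -> (i < N)%N ->
  (forall a, (a <= i)%N -> (t * q)`_a = p`_a) ->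
  t`_i = (p * \sum_(m < N) (1 - q) ^+ m)`_i.
Proof.
move=> q0 iN tq.
have u0 : (1 - q)`_0 = 0 by rewrite coefB coef1 q0 subrr.
(* expand q * (1 + u + ... + u^(N-1)) = 1 - u^N with u = 1 - q *)
have tE : t = (t * q) * (\sum_(m < N) (1 - q) ^+ m) + (1 - q) ^+ N * t.
  have := subrX1 (1 - q) N.
  set S := \sum_(m < N) _ => E.
  have -> : (1 - q) ^+ N = (1 - q - 1) * S + 1 by rewrite -E subrK.
  ring.
have low : ((1 - q) ^+ N * t)`_i = 0.
  rewrite coefM big1 // => -[a /= ai] _.
  by rewrite coef_exp_low ?mul0r //; lia.
rewrite {1}tE coefD low addr0 !coefM; apply: eq_bigr => -[a /= ai] _.
by rewrite tq.
Qed.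

(** The first nonzero coefficient of [p] reappears in [p * t], multiplied by the
    constant term of [t]. *)
Lemma mul_low_coef0 p t s : t`_0 != 0 ->
  (forall e, (e <= s)%N -> (p * t)`_e = 0) -> forall e, (e <= s)%N -> p`_e = 0.
Proof.
move=> t0 pt; elim/ltn_ind => e IH es; apply: (mulIf t0); rewrite mul0r.
have := pt e es.
rewrite coefM big_ord_recr /= subnn big1 ?add0r // => -[i /= ie] _.
by rewrite IH ?mul0r //; lia.
Qed.

(** Carrying a shift ['X^s] along lets products of several factors be expanded
    one factor at a time into sums over independent bounded indices, the
    constraint on the sum of the indices appearing only with the last one
    ([coefXnM_last]). *)
Lemma coefXnM_step p q s i :
  ('X^s * (p * q))`_i = \sum_(a < i.+1) p`_a * ('X^(s + a) * q)`_i.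
Proof.
rewrite mulrCA coefM; apply: eq_bigr => -[a /= ai] _; rewrite !coefXnM.
have -> : (i - a < s)%N = (i < s + a)%N by lia.
by have -> : (i - a - s = i - (s + a))%N by lia.
Qed.

Lemma coefXnM_last q s i :
  ('X^s * q)`_i = \sum_(a < i.+1 | (s + a == i)%N) q`_a.
Proof.
rewrite coefXnM; case: ltnP => si.
  by rewrite big_pred0 // => a; apply/eqP; lia.
have ai : (i - s < i.+1)%N by lia.
rewrite (big_pred1 (Ordinal ai)) // => -[a aa] /=.
by rewrite -val_eqE /=; lia.
Qed.

Lemma coef_exp_lin (a c : F) n i :
  ((a%:P - c *: 'X) ^+ n)`_i = (-1) ^+ i * 'C(n, i)%:R * a ^+ (n - i) * c ^+ i.
Proof.
rewrite exprDn coef_sum; case: (leqP i n) => iN; last first.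
  rewrite bin_small // mulr0 !mul0r big1 // => -[m /= mn] _.
  rewrite coefMn -scaleN1r scalerA exprZn -polyC_exp coefCM coefZ coefXn.
  by rewrite (_ : (i == m) = false) ?mulr0 ?mul0rn //; apply/eqP; lia.
have iN' : (i < n.+1)%N by [].
rewrite (bigD1 (Ordinal iN')) //= big1 => [|[m /= mn] ne].
  rewrite coefMn -scaleN1r scalerA exprZn -polyC_exp coefCM coefZ coefXn.
  by rewrite eqxx mulN1r [(- c) ^+ i]exprNn -mulr_natr !mulr1 addr0; ring.
rewrite coefMn -scaleN1r scalerA exprZn -polyC_exp coefCM coefZ coefXn.
by rewrite (_ : (i == m) = false) ?mulr0 ?mul0rn //; apply/negbTE; rewrite eq_sym.
Qed.

End PowerSeries.

(** * Total degree in (d, j) as the degree in one variable *)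

Section Grading.
Variable F : numFieldType.

(** The restriction of [grad] to polynomials in [j] and [k]. *)
Definition gradj : {rmorphism {poly {poly F}} -> {poly {poly F}}} :=
  horner_eval ('X%:P * 'X) \o map_poly (polyC \o polyC \o horner_eval 0).

(** With target [F[x][T]]: [d] goes to [T], [j] to [x T] and [k] to 0. *)
Definition grad : {rmorphism polyjkd F -> {poly {poly F}}} :=
  horner_eval 'X \o map_poly gradj.

Lemma grad_d : grad (vard F) = 'X.
Proof. by rewrite /= map_polyX /horner_eval hornerX. Qed.

Lemma gradC (c : {poly {poly F}}) : grad c%:P = gradj c.
Proof. by rewrite /= map_polyC /horner_eval hornerC. Qed.

Lemma grad_j : grad (varj F) = 'X%:P * 'X.
Proof. by rewrite gradC /= map_polyX /horner_eval hornerX. Qed.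

Lemma gradj_C c : gradj c%:P = (c`_0)%:P%:P.
Proof.
by rewrite /= map_polyC /horner_eval hornerC /= horner_evalE horner_coef0.
Qed.

Lemma grad_k : grad (vark F) = 0.
Proof. by rewrite gradC gradj_C coefX. Qed.

Lemma grad_cst x : grad (cst x) = x%:P%:P.
Proof. by rewrite gradC gradj_C coefC. Qed.

Lemma coef_gradj c N : (gradj c)`_N = c`_N`_0 *: 'X^N.
Proof.
elim/poly_ind: c N => [|c a IH] N; first by rewrite rmorph0 !coef0 scale0r.
have gX : gradj 'X = 'X%:P * 'X by rewrite /= map_polyX /horner_eval hornerX.
rewrite rmorphD rmorphM gX gradj_C mulrA; move: (gradj c) IH => g IH.
rewrite !coefD !coefMX !coefC coefMC; case: N => [|N] /=.
  by rewrite coef0 !add0r expr0 alg_polyC.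
by rewrite !addr0 coef0 addr0 IH -scalerAl -exprSr.
Qed.

(** The monomial [d^(N-e) j^e] has image [x^e T^N]. *)
Lemma coef_grad p N e :
  (grad p)`_N`_e = if (e <= N)%N then p`_(N - e)`_e`_0 else 0.
Proof.
elim/poly_ind: p N e => [|p c IH] N e; first by rewrite rmorph0 !coef0 if_same.
rewrite rmorphD rmorphM gradC [grad 'X]grad_d; move: (grad p) IH => g IH.
rewrite !coefD !coefMX coef_gradj coefZ coefXn coefC subn_eq0.
case: N => [|N] /=.
  by case: e => [|e]; rewrite ?coef0 ?add0r ?mulr1 ?mulr0.
rewrite IH; case: (ltngtP e N.+1) => [eN|eN|->].
- by rewrite -ltnS eN mulr0 addr0 !coef0 addr0 subSn.
- by rewrite leqNgt (ltnW eN) /= mulr0 addr0.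
by rewrite ltnn !coef0 !add0r mulr1.
Qed.

End Grading.

Arguments grad {F}.

(** * Leading coefficients in a prescribed degree *)

Section TopCoef.
Variable A : comNzRingType.
Implicit Types p q : {poly A}.

(** A degree bound together with the coefficient in that degree, which may be
    zero: this form is stable under products, and under sums with terms of lower
    degree, without any nonvanishing condition. *)
Definition has_top (m : nat) (t : A) p := (size p <= m.+1)%N /\ p`_m = t.

Lemma has_topM m m' t t' p q :
  has_top m t p -> has_top m' t' q -> has_top (m + m') (t * t') (p * q).
Proof.
move=> [sp <-] [sq <-]; split.
  apply: (leq_trans (size_polyMleq _ _)); move: sp sq.
  by set x := size _; set y := size _; clearbody x y; lia.
have mm : (m < (m + m').+1)%N by lia.
rewrite coefM (bigD1 (Ordinal mm)) //= addKn big1 ?addr0 // => -[i /= im] ne.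
have {}ne : i != m by [].
case: (ltnP m i) => im'; first by rewrite nth_default ?mul0r ?(leq_trans sp).
by rewrite [q`__]nth_default ?mulr0 // (leq_trans sq) //; lia.
Qed.

Lemma has_topD m t t' p q :
  has_top m t p -> has_top m t' q -> has_top m (t + t') (p + q).
Proof.
move=> [sp <-] [sq <-]; split; last by rewrite coefD.
by rewrite (leq_trans (size_polyD _ _)) // geq_max sp sq.
Qed.

Lemma has_topN m t p : has_top m t p -> has_top m (- t) (- p).
Proof. by move=> [sp <-]; split; rewrite ?size_polyN ?coefN. Qed.

Lemma has_topB m t t' p q :
  has_top m t p -> has_top m t' q -> has_top m (t - t') (p - q).
Proof. by move=> tp /has_topN; apply: has_topD. Qed.

Lemma has_topC c : has_top 0 c c%:P.
Proof. by split; rewrite ?size_polyC_leq1 ?coefC. Qed.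

Lemma has_topX : has_top 1 1 'X.
Proof. by split; rewrite ?size_polyX ?coefX. Qed.

Lemma has_topC1 c : has_top 1 0 c%:P.
Proof. by split; rewrite ?(leq_trans (size_polyC_leq1 _)) ?coefC. Qed.

Lemma has_top_nat1 n : has_top 1 0 n%:R.
Proof. by rewrite -polyC_natr; apply: has_topC1. Qed.

Lemma has_topCX c : has_top 1 c (c%:P * 'X).
Proof. by have := has_topM (has_topC c) has_topX; rewrite mulr1. Qed.

Lemma has_top_poch t p N : has_top 1 t p -> has_top N (t ^+ N) (poch p N).
Proof.
move=> tp; rewrite /poch; elim: N => [|N IH].
  by rewrite big_ord0 expr0; apply: has_topC.
rewrite big_ord_recr /= -addn1 exprD expr1; apply: has_topM => //.
by rewrite -[t]addr0; apply: has_topD => //; apply: has_top_nat1.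
Qed.

End TopCoef.

(** * Division with remainder and top parts *)

Section Division.
Variable F : numFieldType.

(** The remainder has degree below [M] in [d], so the coefficient of [T^N] in
    its image is divisible by [x^(N-M+1)].  If the image of [Q] had degree
    [s > m] in [T], its leading coefficient times [tD] would be divisible by
    [x^(s+1)], hence so would be that leading coefficient, as [tD] has a nonzero
    constant term; but it has degree at most [s] in [x].  So the image of [Q]
    has degree at most [m], and comparing the coefficients of [T^(m+M)] gives
    the claim up to a multiple of [x^(m+1)]. *)
Lemma grad_division (P Q D r : polyjkd F) m M (tP tD : {poly F}) :
  P = Q * D + r -> has_top (m + M) tP (grad P) -> has_top M tD (grad D) ->
  tD`_0 != 0 -> (size r <= M)%N ->
  forall i, (i <= m)%N -> ((grad Q)`_m * tD)`_i = tP`_i.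
Proof.
move=> PE [sP tPE] [sD tDE] tD0 sr.
have r0 N e : (e + M <= N)%N -> (grad r)`_N`_e = 0.
  move=> eN; rewrite coef_grad; case: leqP => // _.
  rewrite [r`__]nth_default ?coef0 //; apply: (leq_trans sr); lia.
have gE : grad P = grad Q * grad D + grad r by rewrite PE rmorphD rmorphM.
have sQ : (size (grad Q) <= m.+1)%N.
  rewrite leqNgt; apply/negP => sQ.
  pose s := (size (grad Q)).-1.
  have sE : size (grad Q) = s.+1 by rewrite /s prednK // (leq_trans _ sQ).
  have ms : (m < s)%N by rewrite sE in sQ.
  have [_ cQD] : has_top (s + M) ((grad Q)`_s * tD) (grad Q * grad D).
    by apply: has_topM; split; rewrite ?sE.
  have := congr1 (fun p : {poly {poly F}} => p`_(s + M)) gE.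
  rewrite coefD cQD nth_default => [/esym E|]; last first.
    by rewrite (leq_trans sP) //; lia.
  have low : forall e, (e <= s)%N -> (grad Q)`_s`_e = 0.
    apply: (mul_low_coef0 tD0) => e es.
    have := congr1 (fun p : {poly F} => p`_e) E.
    by rewrite coefD r0 ?addr0 ?coef0 ?leq_add2r.
  have : lead_coef (grad Q) = 0.
    apply/polyP => e; rewrite lead_coefE sE coef0.
    by case: (leqP e s) => es; [apply: low | rewrite coef_grad leqNgt es].
  by move/eqP; rewrite lead_coef_eq0 => /eqP Q0; rewrite Q0 size_poly0 in sE.
have [_ cQD] : has_top (m + M) ((grad Q)`_m * tD) (grad Q * grad D).
  by apply: has_topM.
move=> i im; rewrite -tPE gE !coefD cQD r0 ?addr0 //; lia.
Qed.

End Division.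

(** * alpha, beta and gamma as power series coefficients *)

Section Expansions.
Variable F : numFieldType.

Lemma coefM3 (p1 p2 p3 : {poly F}) i : (p1 * (p2 * p3))`_i =
  \sum_(i1 < i.+1) \sum_(i2 < i.+1) \sum_(i3 < i.+1 | (i1 + i2 + i3 == i)%N)
    p1`_i1 * p2`_i2 * p3`_i3.
Proof.
rewrite -[p1 * _]mul1r -(expr0 'X) coefXnM_step; apply: eq_bigr => i1 _.
rewrite coefXnM_step mulr_sumr; apply: eq_bigr => i2 _.
rewrite coefXnM_last !mulr_sumr add0n; apply: eq_bigr => i3 _.
by rewrite !mulrA.
Qed.

Lemma coefM5 (p1 p2 p3 p4 p5 : {poly F}) i :
  (p1 * (p2 * (p3 * (p4 * p5))))`_i =
  \sum_(i1 < i.+1) \sum_(i2 < i.+1) \sum_(i3 < i.+1) \sum_(i4 < i.+1)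
  \sum_(i5 < i.+1 | (i1 + i2 + i3 + i4 + i5 == i)%N)
    p1`_i1 * p2`_i2 * p3`_i3 * p4`_i4 * p5`_i5.
Proof.
rewrite -[p1 * _]mul1r -(expr0 'X) coefXnM_step; apply: eq_bigr => i1 _.
rewrite coefXnM_step mulr_sumr; apply: eq_bigr => i2 _.
rewrite coefXnM_step !mulr_sumr; apply: eq_bigr => i3 _.
rewrite coefXnM_step !mulr_sumr; apply: eq_bigr => i4 _.
rewrite coefXnM_last !mulr_sumr add0n; apply: eq_bigr => i5 _.
by rewrite !mulrA.
Qed.

(** When [i > n] the two powers differ, but the binomial coefficient is 0. *)
Lemma binomial_exprz (a : F) n i :
  'C(n, i)%:R * a ^+ (n - i) = 'C(n, i)%:R * a ^ (n%:Z - i%:Z).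
Proof.
case: (leqP i n) => iN; last by rewrite bin_small // !mul0r.
by rewrite subzn // exprnP.
Qed.

Definition lin (a c : F) : {poly F} := a%:P - c *: 'X.

Lemma linZ (c : F) : c != 0 -> lin c 1 = c *: lin 1 c^-1.
Proof. by move=> c0; rewrite /lin scalerBr scalerA divff // alg_polyC. Qed.

(** The top parts of the dividend and of the divisor, both divided by
    [lam * theta ^+ n.+1] so that [denom] has constant term 1; this is where the
    exponents [n - 1 - i3] and [- i5] in [alpha] come from. *)
Definition numer (lam theta : F) (n : nat) : {poly F} :=
  lin 1 2%:R ^+ 2 * (lin 1 1 ^+ n *
    ((lam * theta)^-1 *: lin (lam * theta) 1 ^+ n *
      (lin (1 - theta) 1 ^+ n * lin 1 theta^-1 ^+ n))).

Definition denom (theta : F) (n : nat) : {poly F} :=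
  lin 1 2%:R * (lin 1 theta^-1 ^+ n * lin 1 2%:R ^+ (2 * n + 1)).

Lemma alphaE (lam theta : F) n i : lam * theta != 0 ->
  alpha lam theta n i = (numer lam theta n)`_i.
Proof.
move=> a0; rewrite /numer coefM5 /alpha mulr_sumr; apply: eq_bigr => i1 _.
rewrite mulr_sumr; apply: eq_bigr => i2 _.
rewrite mulr_sumr; apply: eq_bigr => i3 _.
rewrite mulr_sumr; apply: eq_bigr => i4 _.
rewrite mulr_sumr; apply: eq_bigr => i5 /eqP iE.
rewrite coefZ !coef_exp_lin !expr1n.
have -> : (n%:Z - 1 - i3%:Z = n%:Z - i3%:Z + -1)%R by ring.
rewrite expfzDr // exprN1 -{1}iE !exprD.
have := binomial_exprz (lam * theta) n i3.
have := binomial_exprz (1 - theta) n i4.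
rewrite -[theta ^ _]exprz_inv -exprnP.
set x := (1 - theta) ^ _; set y := (lam * theta) ^ (_ - _) => Ex Ey.
transitivity (2%:R ^+ i1 * (lam * theta)^-1 * theta^-1 ^+ i5
  * ((-1) ^+ i1 * (-1) ^+ i2 * (-1) ^+ i3 * (-1) ^+ i4 * (-1) ^+ i5)
  * 'C(2, i1)%:R * 'C(n, i2)%:R * 'C(n, i5)%:R * ('C(n, i3)%:R * y) *
  ('C(n, i4)%:R * x)).
  by ring.
by rewrite -Ex -Ey; ring.
Qed.

Lemma betaE (theta : F) n i : beta theta n i = (denom theta n)`_i.
Proof.
rewrite /denom -[lin 1 2%:R as X in X * (_ * _)]expr1 coefM3 /beta.
rewrite mulr_sumr; apply: eq_bigr => i1 _.
rewrite mulr_sumr; apply: eq_bigr => i2 _.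
rewrite mulr_sumr; apply: eq_bigr => i3 /eqP iE.
rewrite !coef_exp_lin !expr1n -{1}iE !exprD.
rewrite -[theta ^ _]exprz_inv -exprnP; ring.
Qed.

Lemma horner_lin0 (a c : F) : (lin a c).[0] = a.
Proof. by rewrite /lin hornerD hornerN hornerZ hornerX hornerC mulr0 subr0. Qed.

Lemma denom0 (theta : F) n : (denom theta n)`_0 = 1.
Proof.
rewrite /denom -horner_coef0.
by rewrite !(hornerM, horner_exp, horner_lin0) !expr1n !mulr1.
Qed.

Lemma gammaE (theta : F) n N a : (a < N)%N ->
  gamma theta n a = (\sum_(m < N) (1 - denom theta n) ^+ m)`_a.
Proof.
move=> aN; rewrite coef_geometric //; last first.
  by rewrite coefB coef1 denom0 subrr.
apply: eq_bigr => v _; congr (_ * _); apply: eq_bigr => s _.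
by rewrite coefB coef1 sub0r betaE.
Qed.

End Expansions.

(** * Top parts of the dividend and of the divisor *)

Section TopParts.
Variables (F : numFieldType) (lam theta : F).
Local Notation d := (vard F).
Local Notation j := (varj F).
Local Notation k := (vark F).

Lemma has_top_natC (A : comNzRingType) n : has_top 0 (n%:R : A) n%:R.
Proof. by rewrite -polyC_natr; apply: has_topC. Qed.

Lemma top_cd (a : F) : has_top 1 a%:P (grad (cst a * d)).
Proof. by rewrite rmorphM grad_d grad_cst; apply: has_topCX. Qed.

Lemma top_j : has_top 1 (1 *: 'X) (grad j).
Proof. by rewrite grad_j scale1r; apply: has_topCX. Qed.

Lemma top_2j : has_top 1 (2%:R *: 'X) (grad (2%:R * j)).
Proof.
rewrite rmorphM rmorph_nat grad_j -mul_polyC polyC_natr.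
exact: (has_topM (has_top_natC _ _) (has_topCX _)).
Qed.

Lemma top_d : has_top 1 1%:P (grad d).
Proof. by rewrite grad_d; apply: has_topX. Qed.

Lemma top_nat n : has_top 1 0 (grad (n%:R : polyjkd F)).
Proof. by rewrite rmorph_nat; apply: has_top_nat1. Qed.

Lemma top_k : has_top 1 0 (grad k).
Proof. by rewrite grad_k; apply: (has_top_nat1 _ 0). Qed.

Lemma top_add m t (p p' : polyjkd F) :
  has_top m t (grad p) -> has_top m 0 (grad p') ->
  has_top m t (grad (p + p')).
Proof. by move=> tp tq; rewrite rmorphD -[t]addr0; apply: has_topD. Qed.

Lemma top_sub m t (p p' : polyjkd F) :
  has_top m t (grad p) -> has_top m 0 (grad p') ->
  has_top m t (grad (p - p')).
Proof. by move=> tp tq; rewrite rmorphB -[t]subr0; apply: has_topB. Qed.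

Lemma top_lin a c (p p' : polyjkd F) : has_top 1 a%:P (grad p) ->
  has_top 1 (c *: 'X) (grad p') -> has_top 1 (lin a c) (grad (p - p')).
Proof. by move=> tp tq; rewrite rmorphB; apply: has_topB. Qed.

Lemma rmorph_poch (A B : comNzRingType) (f : {rmorphism A -> B}) x N :
  f (poch x N) = poch (f x) N.
Proof.
by rewrite /poch rmorph_prod; apply: eq_bigr => i _; rewrite rmorphD rmorph_nat.
Qed.

Lemma top_poch t (p : polyjkd F) N :
  has_top 1 t (grad p) -> has_top N (t ^+ N) (grad (poch p N)).
Proof. by move=> tp; rewrite rmorph_poch; apply: has_top_poch. Qed.

Lemma top_mul m m' t t' (p q : polyjkd F) :
  has_top m t (grad p) -> has_top m' t' (grad q) ->
  has_top (m + m') (t * t') (grad (p * q)).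
Proof. by move=> tp tq; rewrite rmorphM; apply: has_topM. Qed.

Lemma top_Ppol n : has_top (1 + 1 + n + n + n + n)
  (lin 1 2%:R * lin 1 2%:R * lin 1 1 ^+ n * lin (1 - theta) 1 ^+ n
    * lin (lam * theta) 1 ^+ n * lin theta 1 ^+ n) (grad (Ppol lam theta n n)).
Proof.
have t1 : has_top 1 0 (grad (1 : polyjkd F)) by apply: (top_nat 1).
apply: (top_mul (top_mul (top_mul (top_mul (top_mul _ _) _) _) _) _).
- by apply: top_sub t1; apply: top_lin; [apply: top_d | apply: top_2j].
- apply: top_sub t1; apply: top_lin; last exact: top_2j.
  by rewrite -natrM; apply: top_add; [apply: top_d | apply: top_nat].
- by apply: top_poch; apply: top_lin; [apply: top_d | apply: top_j].
- by apply: top_poch; apply: top_lin; [apply: top_cd | apply: top_j].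
- apply: top_poch; apply: top_add (top_k); apply: top_lin; last exact: top_j.
  by apply: top_sub (top_nat n); apply: top_add (top_nat n); apply: top_cd.
- apply: top_poch; apply: top_add (top_k); apply: top_lin; last exact: top_j.
  by apply: top_sub (top_nat n); apply: top_add (top_nat n); apply: top_cd.
Qed.

Lemma top_Dpol n : has_top (0 + 1 + 1 + n + (n + n + 1))
  ((lam * theta)%:P * 1 * lin 1 2%:R * lin theta 1 ^+ n
    * lin 1 2%:R ^+ (n + n + 1)) (grad (Dpol lam theta n n 0)).
Proof.
have t1 : has_top 1 0 (grad (1 : polyjkd F)) by apply: (top_nat 1).
apply: (top_mul (top_mul (top_mul (top_mul _ _) _) _) _).
- by rewrite grad_cst; apply: has_topC.
- by rewrite expr1; apply: top_d.
- apply: top_sub t1; apply: top_lin; last exact: top_2j.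
  by apply: top_add (top_nat n); apply: top_d.
- by apply: top_poch; apply: top_lin; [apply: top_cd | apply: top_j].
apply: top_poch; apply: top_add top_k; apply: top_sub t1.
apply: top_lin; last exact: top_2j.
by apply: top_add (top_nat n); apply: top_sub (top_nat n); apply: top_d.
Qed.

(** Here the degree is that in [d] alone: [j] and [k] count as constants. *)
Lemma size_Dpol n : (size (Dpol lam theta n n 0) <= (3 * n + 3).+1)%N.
Proof.
have tj c : has_top 1 0 (c%:P : polyjkd F) by apply: has_topC1.
have tn m : has_top 1 0 (m%:R : polyjkd F) by apply: has_top_nat1.
have t2j : has_top 1 0 (2%:R * j).
  by have := has_topM (has_top_natC _ 2) (tj 'X); rewrite mulr0.
have [] : has_top (0 + 1 + 1 + n + (n + n + 1))
    ((lam * theta)%:P%:P * 1 * (1 + 0 - 0 - 0) * (theta%:P%:P - 0) ^+ n *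
     (1 - 0 + 0 - 0 - 0 + 0) ^+ (n + n + 1)) (Dpol lam theta n n 0); last first.
  by move=> + _; rewrite (_ : 0 + 1 + 1 + n + (n + n + 1) = 3 * n + 3)%N //; lia.
do ?apply: has_topM.
- exact: has_topC.
- exact: has_topX.
- apply: has_topB (tn 1%N); apply: has_topB t2j.
  by apply: has_topD (tn n); apply: has_topX.
- by apply: has_top_poch; apply: has_topB; [apply: has_topCX | apply: tj].
apply: has_top_poch; apply: has_topD (tj _).
apply: has_topB (tn 1%N); apply: has_topB t2j; apply: has_topD (tn n).
by apply: has_topB (tn n); apply: has_topX.
Qed.

End TopParts.

Section QuotientTop.
Variables (F : numFieldType) (lam theta : F) (n : nat).
Hypotheses (lam0 : lam != 0) (theta0 : theta != 0) (theta1 : theta != 1).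

Let c := lam * theta * theta ^+ n.

Lemma top_Ppol_numer :
  has_top (4 * n + 2) (c *: numer lam theta n) (grad (Ppol lam theta n n)).
Proof.
have := top_Ppol lam theta n; congr has_top; first by clear; lia.
have E : (lam * theta)%:P * (lam * theta)^-1%:P = 1 :> {poly F}.
  by rewrite -polyCM divff ?mulf_neq0.
rewrite (linZ theta0) exprZn /numer /c -!mul_polyC polyCM -[LHS]mul1r -E; ring.
Qed.

Lemma top_Dpol_denom :
  has_top (3 * n + 3) (c *: denom theta n) (grad (Dpol lam theta n n 0)).
Proof.
have := top_Dpol lam theta n; congr has_top; first by clear; lia.
have -> : (n + n + 1 = 2 * n + 1)%N by clear; lia.
rewrite (linZ theta0) exprZn /denom /c -!mul_polyC !polyCM; ring.
Qed.

Lemma quotient_top i : (i < n)%N ->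
  ((grad (Qpol lam theta n n 0))`_(n - 1) * denom theta n)`_i
  = (numer lam theta n)`_i.
Proof.
move=> iN; have c0 : c != 0 by rewrite !mulf_neq0 ?expf_neq0.
have D0 : Dpol lam theta n n 0 != 0.
  apply/eqP => D0; have := Dpol_lead_unit lam0 theta0 theta1 n n 0.
  by rewrite D0 lead_coef0 unitr0.
have sr : (size (Ppol lam theta n n %% Dpol lam theta n n 0)%R <= 3 * n + 3)%N.
  rewrite -ltnS (leq_trans _ (size_Dpol lam theta n)) //.
  exact: Pdiv.CommonIdomain.ltn_modpN0.
have nE : (4 * n + 2 = n - 1 + (3 * n + 3))%N by clear - iN; lia.
have tP := top_Ppol_numer; rewrite nE in tP.
have tD0 : (c *: denom theta n)`_0 != 0 by rewrite coefZ denom0 mulr1.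
have i1 : (i <= n - 1)%N by clear - iN; lia.
have := grad_division (Ppol_divE lam0 theta0 theta1 n n 0) tP top_Dpol_denom
  tD0 sr i1.
by rewrite -scalerAr !coefZ => /(mulfI c0).
Qed.

End QuotientTop.

Theorem proposition4 (R : realFieldType) (lam theta : R)
  (hlam : 0 < lam <= 1) (htheta : 0 < theta < 1)
  (n l : nat) (hn : (1 <= n)%N) (hl : (l <= n - 1)%N) :
  ccoef lam theta n n l =
  \sum_(0 <= v < (n - l - 1).+1) alpha lam theta n v * gamma theta n (n - l - 1 - v).
Proof.
have [lam_gt0 _] := andP hlam; have [theta_gt0 theta_lt1] := andP htheta.
have lam0 : lam != 0 by rewrite gt_eqF.
have theta0 : theta != 0 by rewrite gt_eqF.
have theta1 : theta != 1 by rewrite lt_eqF.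
have iN : (n - l - 1 < n)%N by clear - hn hl; lia.
have iN1 : (n - l - 1 <= n - 1)%N by clear - hn hl; lia.
rewrite /ccoef /qcoef subnn; move: (n - l - 1)%N iN iN1 => i iN iN1.
transitivity (grad (Qpol lam theta n n 0))`_(n - 1)`_i.
  by rewrite coef_grad iN1.
rewrite (@coef_quotient _ (numer lam theta n) _ _ n i (denom0 theta n)) //
  => [|a ai].
  rewrite coefM big_mkord; apply: eq_bigr => v _.
  have vN : (i - v < n)%N := leq_ltn_trans (leq_subr v i) iN.
  by rewrite (alphaE _ _ (mulf_neq0 lam0 theta0)) (gammaE _ _ vN).
exact: quotient_top lam0 theta0 theta1 _ (leq_ltn_trans ai iN).
Qed.
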